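(* Let $\mathcal W$ be a measure matrix of order $\mathcal N$ whose moment matrix $G_{\mathcal W}$ is $LU$-factorizable, with monic polynomial sequences $P_1=(P_{1,l})_{l\ge 0}$, $P_2=(P_{2,l})_{l\ge 0}$ and diagonal factor $H=\mathrm{diag}(h_0,h_1,\dots)$. Then $P_1$ and $P_2$ are Sobolev bi-orthogonal: $$(P_{1,r},P_{2,k};\mathcal W)=h_r\,\delta_{r,k}\qquad \text{for all } r,k\ge 0.$$ Moreover, for all $l\ge 0$ and all $0\le r\le l$, $$(P_{1,l},x^r;\mathcal W)=\delta_{l,r}h_r,\qquad (x^r,P_{2,l};\mathcal W)=h_r\delta_{r,l},$$ that is, $$\sum_{k=0}^{l}\sum_{j=0}^{r}\int P_{1,l}^{(k)}(x)\,\frac{d^jx^r}{dx^j}\,d\mu_{k,j}(x)=\begin{cases}0& r<l\\ h_l& r=l\end{cases},\qquad \sum_{k=0}^{l}\sum_{j=0}^{r}\int \frac{d^jx^r}{dx^j}\,P_{2,l}^{(k)}(x)\,d\mu_{j,k}(x)=\begin{cases}0& r<l\\ h_l& r=l.\end{cases}$$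
   Context: Semi-infinite matrices and vectors are indexed from $0$; $A^{[k]}$ denotes the leading $k\times k$ truncation. A measure matrix of order $\mathcal N$ is a semi-infinite matrix $\mathcal W=(d\mu_{i,j})_{i,j\ge0}$ of (possibly signed) Borel measures on sets $\Omega_{i,j}\subseteq\mathbb R$, with $d\mu_{i,j}=0$ if $i>\mathcal N$ or $j>\mathcal N$. Its Sobolev bilinear form is $(f,h;\mathcal W)=\sum_{n,r=0}^{\mathcal N}\int_{\Omega_{n,r}}f^{(n)}(x)h^{(r)}(x)\,d\mu_{n,r}(x)$, assumed finite on polynomials. The moment matrix is $(G_{\mathcal W})_{n,p}=(x^n,x^p;\mathcal W)$. It is $LU$-factorizable if $\det G_{\mathcal W}^{[k]}\ne0$ for all $k\ge1$; then there are unique lower unitriangular $S_1,S_2$ and diagonal $H=\mathrm{diag}(h_0,h_1,\dots)$ with $G_{\mathcal W}=S_1^{-1}H(S_2^{-1})^{\top}$. With $\chi(x)=(1,x,x^2,\dots)^\top$, the monic sequences are $P_1(x)=S_1\chi(x)$, $P_2(x)=S_2\chi(x)$. *)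

(* Defs.v *)
(* MathComp-Analysis *)
From HB Require Import structures.
From mathcomp Require Import all_boot all_order all_algebra.
From mathcomp Require Import all_classical all_reals all_analysis.

Set Implicit Arguments.
Unset Strict Implicit.
Unset Printing Implicit Defensive.

Import Order.TTheory GRing.Theory Num.Theory.
Import numFieldNormedType.Exports.

Local Open Scope classical_set_scope.
Local Open Scope ring_scope.

Section ChargeIntegral.
Context d (T : measurableType d) (R : realType).
Variable nu : {charge set T -> \bar R}.

Definition hahn_pos : set T := sval (cid (Hahn_decomposition nu)).

Definition hahn_neg : set T := sval (cid (svalP (cid (Hahn_decomposition nu)))).

Definition hahn_posneg : hahn_decomposition nu hahn_pos hahn_neg :=
  svalP (cid (svalP (cid (Hahn_decomposition nu)))).

(* The Jordan decomposition does not depend on the Hahn decomposition chosen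
   (Hahn_decomposition_uniq), so neither do the next two definitions. *)
Definition charge_integrable (f : T -> R) : Prop :=
  (charge_variation hahn_posneg).-integrable setT (EFin \o f).

Definition charge_integral (f : T -> R) : R :=
  Rintegral (jordan_pos hahn_posneg) setT f
  - Rintegral (jordan_neg hahn_posneg) setT f.

End ChargeIntegral.

Section SemiInfinite.
Variable R : realType.

Definition simx := nat -> nat -> R.

Definition simx_trunc (A : simx) (k : nat) : 'M[R]_k :=
  \matrix_(i < k, j < k) A i j.

(* The sum over all k is the finitely supported one (0 on infinite supports).
   Every product used below has a row-finite left factor. *)
Definition simx_mul (A B : simx) : simx :=
  fun i j => \sum_(k \in [set: nat]) A i k * B k j.

Definition simx_tr (A : simx) : simx := fun i j => A j i.

Definition simx_diag (h : nat -> R) : simx := fun i j => h i * (i == j)%:R.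

Definition simx_id : simx := simx_diag (fun=> 1).

Definition lower_triangular (A : simx) : Prop :=
  forall i j, (i < j)%N -> A i j = 0.

Definition lower_unitriangular (A : simx) : Prop :=
  lower_triangular A /\ forall i, A i i = 1.

(* [B] is the inverse of [A] in the ring of lower triangular matrices; there it
   is unique, and it exists as soon as [A] is lower unitriangular. *)
Definition simx_inverse (A B : simx) : Prop :=
  [/\ lower_triangular B, simx_mul A B = simx_id & simx_mul B A = simx_id].

Definition LU_factorizable (G : simx) : Prop :=
  forall k, (1 <= k)%N -> \det (simx_trunc G k) != 0.

(* G = S1^-1 H (S2^-1)^T with H = diag(h_0, h_1, ...) *)
Definition LU_factorization (G S1 S2 : simx) (h : nat -> R) : Prop :=
  [/\ lower_unitriangular S1, lower_unitriangular S2 &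
      exists T1 T2, [/\ simx_inverse S1 T1, simx_inverse S2 T2 &
        G = simx_mul (simx_mul T1 (simx_diag h)) (simx_tr T2)]].

(* The l-th entry of S chi(x), chi(x) = (1, x, x^2, ...)^T, for S lower
   triangular. *)
Definition monic_seq (S : simx) (l : nat) : {poly R} :=
  \sum_(k < l.+1) S l k *: 'X^k.

End SemiInfinite.

(* A (signed) Borel measure on Omega, Omega being an arbitrary subset of R with
   the trace Borel sigma-algebra, is the same thing as a charge on the Borel
   sets of R that vanishes on every Borel set disjoint from Omega; the integral
   over Omega is then the integral of this charge over R. Charges are finite:
   a signed measure for which the constant 1 is integrable is finite. *)
Record measure_matrix (R : realType) (N : nat) := MeasureMatrix {
  mm_dom : nat -> nat -> set R;
  mm_mu : nat -> nat -> {charge set (measurableTypeR R) -> \bar R};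
  mm_carried : forall i j (A : set (measurableTypeR R)), measurable A ->
    A `&` mm_dom i j = set0 -> mm_mu i j A = 0%E;
  mm_order : forall i j (A : set (measurableTypeR R)), measurable A ->
    (N < i)%N || (N < j)%N -> mm_mu i j A = 0%E
}.

Section Sobolev.
Variables (R : realType) (N : nat) (W : measure_matrix R N).

Definition mm_int (i j : nat) (f : R -> R) : R := charge_integral (mm_mu W i j) f.

Definition finite_on_polynomials : Prop :=
  forall (n r : nat) (f h : {poly R}), (n <= N)%N -> (r <= N)%N ->
    charge_integrable (mm_mu W n r) (fun x : R => f^`(n).[x] * h^`(r).[x]).

Definition sobolev (f h : {poly R}) : R :=
  \sum_(n < N.+1) \sum_(r < N.+1)
    mm_int n r (fun x : R => f^`(n).[x] * h^`(r).[x]).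

Definition moment_matrix : simx R := fun n p => sobolev 'X^n 'X^p.

End Sobolev.

(* Main.v *)
Require Import Defs.
From HB Require Import structures.
From mathcomp Require Import all_boot all_order all_algebra.
From mathcomp Require Import all_classical all_reals all_analysis.
From mathcomp Require Import measurable_realfun ring.

Set Implicit Arguments.
Unset Strict Implicit.
Unset Printing Implicit Defensive.

Import Order.TTheory GRing.Theory Num.Theory.
Import numFieldNormedType.Exports.

Local Open Scope ring_scope.

(** Since the Sobolev form is bilinear on polynomials, its values on the rows of
    S1 chi and S2 chi are matrix products with the moment matrix G:
    (P1_l, x^p) is the entry (l, p) of S1 G, and (x^p, P2_l) is the entry (p, l)
    of G S2^T.  Writing T1, T2 for the inverses of S1, S2, the factorization
    G = T1 H T2^T gives S1 G = H T2^T and G S2^T = T1 H (LU_mul_left and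
    LU_mul_right).  Both T1 and T2 are lower unitriangular, so the entries with
    p <= l are those of H: these are the orthogonality relations against the
    powers of x.  Multiplying once more, S1 G S2^T = H (S2 T2)^T = H is the
    bi-orthogonality.

    Two points need care.  Bilinearity rests on the integrability of all products
    of derivatives, because the integral against a signed measure is the
    difference of the integrals against its Jordan parts
    (charge_integral_linear).  The explicit sums run over derivative orders up to
    the degrees instead of up to N; they give the same value because derivatives
    of order above the degree and measures of index above N both vanish
    (sobolev_size).

    Every matrix product here has a row-finite factor, and the infinite sums
    are replaced throughout by finite ones (simx_mul_ord). *)

(** * Integration against a signed measure *)

Section ChargeIntegralTheory.
Context d (T : measurableType d) (R : realType).
Variable nu : {charge set T -> \bar R}.

Lemma integrable_le_measure (m1 m2 : {measure set T -> \bar R})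
    (f : T -> \bar R) :
  (forall A, measurable A -> (m1 A <= m2 A)%E) ->
  m2.-integrable setT f -> m1.-integrable setT f.
Proof.
move=> m12 /integrableP[mf foo]; apply/integrableP; split => //.
apply: le_lt_trans foo; apply: ge0_le_measure_integral => //.
exact: measurableT_comp.
Qed.

Lemma charge_integrable_pos (f : T -> R) : charge_integrable nu f ->
  (jordan_pos (hahn_posneg nu)).-integrable setT (EFin \o f).
Proof.
apply: integrable_le_measure => A mA.
by rewrite /charge_variation /= leeDl.
Qed.

Lemma charge_integrable_neg (f : T -> R) : charge_integrable nu f ->
  (jordan_neg (hahn_posneg nu)).-integrable setT (EFin \o f).
Proof.
apply: integrable_le_measure => A mA.
by rewrite /charge_variation /= leeDr.
Qed.

(** Integrability is required against the variation, which dominates each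
    Jordan part; linearity is thus inherited from the two positive measures. *)
Lemma charge_integral_linear (a : R) (f g : T -> R) :
  charge_integrable nu f -> charge_integrable nu g ->
  charge_integral nu (fun x => a * f x + g x) =
  a * charge_integral nu f + charge_integral nu g.
Proof.
have RI (m : {measure set T -> \bar R}) :
    m.-integrable setT (EFin \o f) -> m.-integrable setT (EFin \o g) ->
    Rintegral m setT (fun x => a * f x + g x) =
    a * Rintegral m setT f + Rintegral m setT g.
  move=> fi gi; rewrite RintegralD//; first by rewrite RintegralZl.
  have := integrableZl measurableT a fi.
  by apply: eq_integrable => // x _ /=; rewrite EFinM.
move=> fi gi; rewrite /charge_integral !RI;
  by [ring | exact: charge_integrable_pos | exact: charge_integrable_neg].
Qed.

Lemma charge_integral_cst0 : charge_integral nu (fun=> 0) = 0.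
Proof. by rewrite /charge_integral !Rintegral_cst// !mul0r subrr. Qed.

(** A null charge is dominated by the zero measure, and then so are both of its
    Jordan parts. *)
Lemma charge_integral_null (f : T -> R) :
  (forall A, measurable A -> nu A = 0%E) -> charge_integral nu f = 0.
Proof.
move=> nu0; have RI0 (m : {measure set T -> \bar R}) :
    (forall A, measurable A -> m A = 0%E) -> Rintegral m setT f = 0.
  move=> m0; rewrite /Rintegral (@eq_measure_integral _ _ _ _ mzero).
    by rewrite integral_measure_zero.
  by move=> A mA _; rewrite m0.
have nu_mzero : nu `<< @mzero _ T R.
  by apply/null_content_dominatesP => A mA _; exact: nu0.
have /null_content_dominatesP pos0 :=
  jordan_pos_dominates (hahn_posneg nu) nu_mzero.
have /null_content_dominatesP neg0 :=
  jordan_neg_dominates (hahn_posneg nu) nu_mzero.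
by rewrite /charge_integral !RI0 ?subrr// => A mA; [exact: neg0|exact: pos0].
Qed.

End ChargeIntegralTheory.

(** * Finite sums and products of semi-infinite matrices *)

Lemma sum_ord_support (R : zmodType) (F : nat -> R) (m n : nat) :
  (forall i, (m <= i)%N -> F i = 0) -> (forall i, (n <= i)%N -> F i = 0) ->
  \sum_(i < m) F i = \sum_(i < n) F i.
Proof.
have H k l : (k <= l)%N -> (forall i, (k <= i)%N -> F i = 0) ->
    \sum_(i < k) F i = \sum_(i < l) F i.
  move=> kl F0; rewrite -!(big_mkord xpredT) [RHS](big_cat_nat (leq0n k) kl)//=.
  rewrite [X in _ = _ + X]big_nat_cond [X in _ = _ + X]big1 ?addr0//.
  by move=> i /andP[/andP[/F0 ->]].
move=> Fm Fn; have [mn|/ltnW nm] := leqP m n; first exact: H.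
by apply/esym/H.
Qed.

Section SemiInfiniteTheory.
Variable R : realType.
Implicit Types (A B S T : simx R) (h : nat -> R).

Lemma simx_mul_ord A B (i j n : nat) :
  (forall k, (n <= k)%N -> A i k * B k j = 0) ->
  simx_mul A B i j = \sum_(k < n) A i k * B k j.
Proof.
move=> AB0; rewrite /simx_mul (fsbig_ord _ n (fun k => A i k * B k j)).
apply/esym/fsbig_widen => // k [_ /= /negP]; rewrite -leqNgt; exact: AB0.
Qed.

Lemma simx_mul_diag A h (i j : nat) : simx_mul A (simx_diag h) i j = A i j * h j.
Proof.
rewrite (@simx_mul_ord _ _ _ _ j.+1).
  rewrite big_ord_recr /= big1 => [|k _].
    by rewrite add0r /simx_diag eqxx mulr1.
  by rewrite /simx_diag (ltn_eqF (ltn_ord k)) !mulr0.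
by move=> k jk; rewrite /simx_diag (gtn_eqF jk) !mulr0.
Qed.

Lemma lower_triangular_mulE A B (i j n : nat) :
  lower_triangular A -> (i < n)%N ->
  simx_mul A B i j = \sum_(k < n) A i k * B k j.
Proof.
move=> At lt_in; apply: simx_mul_ord => k nk.
by rewrite At ?mul0r// (leq_trans lt_in).
Qed.

(** As S and T are both lower triangular, the diagonal of S T is the entrywise
    product of their diagonals. *)
Lemma simx_inverse_diag S T (i : nat) :
  lower_unitriangular S -> simx_inverse S T -> T i i = 1.
Proof.
move=> [St S1] [Tt ST _].
have := congr1 (fun A : simx R => A i i) ST.
rewrite /simx_id /simx_diag eqxx mulr1 (lower_triangular_mulE _ _ St (ltnSn i)).
rewrite big_ord_recr /= S1 mul1r big1 ?add0r// => k _.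
by rewrite (Tt k i) ?mulr0.
Qed.

Lemma simx_inverse_entry S T (i j : nat) :
  lower_unitriangular S -> simx_inverse S T -> (i <= j)%N ->
  T i j = (i == j)%:R.
Proof.
move=> Su ST; rewrite leq_eqVlt => /predU1P[<-|ij].
  by rewrite eqxx (simx_inverse_diag _ Su ST).
by rewrite (ltn_eqF ij); case: ST => Tt _ _; rewrite Tt.
Qed.

(** This is S (T F) = F for a column F. The sums are cut at the row index r,
    which is legitimate because row r of S only sees rows of T up to r. *)
Lemma simx_inverse_cancel S T (F : nat -> R) (r : nat) :
  lower_triangular S -> simx_mul S T = simx_id R ->
  \sum_(i < r.+1) S r i * (\sum_(k < r.+1) T i k * F k) = F r.
Proof.
move=> St ST.
under eq_bigr do rewrite big_distrr /=.
rewrite exchange_big /=.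
have STr (k : nat) : \sum_(i < r.+1) S r i * T i k = (r == k)%:R.
  rewrite -(lower_triangular_mulE _ _ St (ltnSn r)) ST.
  by rewrite /simx_id /simx_diag mul1r.
under eq_bigr => k _.
  under eq_bigr do rewrite mulrA.
  rewrite -big_distrl /= STr; over.
rewrite big_ord_recr /= eqxx mul1r big1 ?add0r// => k _.
by rewrite (gtn_eqF (ltn_ord k)) mul0r.
Qed.

Section Factorized.
Variables (T1 T2 : simx R) (h : nat -> R).
Hypotheses (T1t : lower_triangular T1) (T2t : lower_triangular T2).
Let G := simx_mul (simx_mul T1 (simx_diag h)) (simx_tr T2).

(** Row i of T1 stops at i and column j of T2^T stops at j, so the middle index
    may be cut beyond either one; the two cancellations below use different
    sides of this choice. *)
Lemma LU_entry (i j n : nat) : (i < n)%N || (j < n)%N ->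
  G i j = \sum_(k < n) T1 i k * h k * T2 j k.
Proof.
move=> ijn; rewrite /G (@simx_mul_ord _ _ _ _ n).
  by apply: eq_bigr => k _; rewrite simx_mul_diag.
move=> k nk; rewrite simx_mul_diag /simx_tr.
by case/orP: ijn => /leq_trans/(_ nk) ltk;
  [rewrite (T1t ltk) !mul0r | rewrite (T2t ltk) mulr0].
Qed.

(** As G = T1 diag(h) T2^T and S1 T1 = 1, this is an entry of S1 G = diag(h) T2^T. *)
Lemma LU_mul_left S1 (r p : nat) :
  lower_triangular S1 -> simx_mul S1 T1 = simx_id R ->
  \sum_(i < r.+1) S1 r i * G i p = h r * T2 p r.
Proof.
move=> S1t S1T1.
rewrite -(simx_inverse_cancel (fun k => h k * T2 p k) r S1t S1T1).
apply: eq_bigr => i _; rewrite (@LU_entry _ _ r.+1) ?ltn_ord//.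
by congr (_ * _); apply: eq_bigr => k _; rewrite mulrA.
Qed.

(** Symmetrically, this is an entry of G S2^T = T1 diag(h) (S2 T2)^T = T1 diag(h). *)
Lemma LU_mul_right S2 (p r : nat) :
  lower_triangular S2 -> simx_mul S2 T2 = simx_id R ->
  \sum_(j < r.+1) S2 r j * G p j = T1 p r * h r.
Proof.
move=> S2t S2T2.
rewrite -(simx_inverse_cancel (fun k => T1 p k * h k) r S2t S2T2).
apply: eq_bigr => j _; rewrite (@LU_entry _ _ r.+1) ?ltn_ord ?orbT//.
by congr (_ * _); apply: eq_bigr => k _; rewrite mulrC.
Qed.

End Factorized.

Lemma size_monic_seq S (l : nat) : (size (monic_seq S l) <= l.+1)%N.
Proof.
rewrite /monic_seq; apply: (leq_trans (size_sum _ _ _)); apply/bigmax_leqP => k _.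
by apply: (leq_trans (size_scale_leq _ _)); rewrite size_polyXn ltn_ord.
Qed.

End SemiInfiniteTheory.

(** * The Sobolev form *)

Section SobolevTheory.
Variables (R : realType) (N : nat) (W : measure_matrix R N).

Lemma mm_int_order (n r : nat) (f : R -> R) :
  (N < n)%N || (N < r)%N -> mm_int W n r f = 0.
Proof.
move=> Nnr; apply: charge_integral_null => A mA; exact: mm_order.
Qed.

(** Terms of order above the degrees contain a vanishing derivative and terms of
    order above N an absent measure, so either pair of bounds cuts the same
    double sum. *)
Lemma sobolev_size (f h : {poly R}) (m n : nat) :
  (size f <= m)%N -> (size h <= n)%N ->
  sobolev W f h = \sum_(k < m) \sum_(j < n)
    mm_int W k j (fun x : R => f^`(k).[x] * h^`(j).[x]).
Proof.
move=> fm hn.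
have f0 (k j : nat) : (m <= k)%N ->
    mm_int W k j (fun x : R => f^`(k).[x] * h^`(j).[x]) = 0.
  move=> mk; rewrite derivn_poly0 ?(leq_trans fm)//.
  rewrite -[RHS](charge_integral_cst0 (mm_mu W k j)).
  by congr charge_integral; apply/funext => x; rewrite horner0 mul0r.
have h0 (k j : nat) : (n <= j)%N ->
    mm_int W k j (fun x : R => f^`(k).[x] * h^`(j).[x]) = 0.
  move=> nj; rewrite (@derivn_poly0 _ h) ?(leq_trans hn)//.
  rewrite -[RHS](charge_integral_cst0 (mm_mu W k j)).
  by congr charge_integral; apply/funext => x; rewrite horner0 mulr0.
rewrite /sobolev (sum_ord_support (n := m) (F := fun k => \sum_(j < N.+1)
    mm_int W k j (fun x : R => f^`(k).[x] * h^`(j).[x]))).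
- apply: eq_bigr => k _.
  apply: (sum_ord_support (F := fun j =>
    mm_int W k j (fun x : R => f^`(k).[x] * h^`(j).[x]))) => j Nj.
    by rewrite mm_int_order// Nj orbT.
  exact: h0.
- by move=> k Nk; rewrite big1// => j _; rewrite mm_int_order// Nk.
- by move=> k mk; rewrite big1// => j _; rewrite f0.
Qed.

Hypothesis Wfin : finite_on_polynomials W.

Lemma sobolev_linearl (a : R) (f g h : {poly R}) :
  sobolev W (a *: f + g) h = a * sobolev W f h + sobolev W g h.
Proof.
rewrite /sobolev big_distrr -big_split /=; apply: eq_bigr => n _.
rewrite big_distrr -big_split /=; apply: eq_bigr => r _.
have nN := ltn_ord n; have rN := ltn_ord r; rewrite !ltnS in nN rN.
rewrite -(charge_integral_linear a (Wfin f h nN rN) (Wfin g h nN rN)).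
congr charge_integral; apply/funext => x.
by rewrite derivnD derivnZ hornerD hornerZ mulrDl mulrA.
Qed.

Lemma sobolev_linearr (a : R) (f g h : {poly R}) :
  sobolev W h (a *: f + g) = a * sobolev W h f + sobolev W h g.
Proof.
rewrite /sobolev big_distrr -big_split /=; apply: eq_bigr => n _.
rewrite big_distrr -big_split /=; apply: eq_bigr => r _.
have nN := ltn_ord n; have rN := ltn_ord r; rewrite !ltnS in nN rN.
rewrite -(charge_integral_linear a (Wfin h f nN rN) (Wfin h g nN rN)).
congr charge_integral; apply/funext => x.
by rewrite derivnD derivnZ hornerD hornerZ mulrDr mulrCA.
Qed.

Lemma sobolev_monic_seql (S : simx R) (l : nat) (h : {poly R}) :
  sobolev W (monic_seq S l) h = \sum_(k < l.+1) S l k * sobolev W 'X^k h.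
Proof.
(* Linearity at a = -1 and f = g = 0 gives (0, h) = - (0, h) + (0, h). *)
have s0 : sobolev W 0 h = 0.
  by have := sobolev_linearl (-1) 0 0 h; rewrite scaler0 addr0 mulN1r addNr.
have sD : {morph (fun f => sobolev W f h) : f g / f + g}.
  by move=> f g; rewrite -[f]scale1r sobolev_linearl scale1r mul1r.
rewrite /monic_seq (big_morph _ sD s0); apply: eq_bigr => k _.
by rewrite -[_ *: _]addr0 sobolev_linearl s0 addr0.
Qed.

Lemma sobolev_monic_seqr (S : simx R) (l : nat) (f : {poly R}) :
  sobolev W f (monic_seq S l) = \sum_(k < l.+1) S l k * sobolev W f 'X^k.
Proof.
(* As on the left, by linearity at a = -1. *)
have s0 : sobolev W f 0 = 0.
  by have := sobolev_linearr (-1) 0 0 f; rewrite scaler0 addr0 mulN1r addNr.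
have sD : {morph (fun h => sobolev W f h) : g h / g + h}.
  by move=> g h; rewrite -[g]scale1r sobolev_linearr scale1r mul1r.
rewrite /monic_seq (big_morph _ sD s0); apply: eq_bigr => k _.
by rewrite -[_ *: _]addr0 sobolev_linearr s0 addr0.
Qed.

End SobolevTheory.

(** * Bi-orthogonality *)

Theorem proposition3 (R : realType) (N : nat) (W : measure_matrix R N)
    (Wfin : finite_on_polynomials W)
    (WLU : LU_factorizable (moment_matrix W))
    (S1 S2 : simx R) (h : nat -> R)
    (WS : LU_factorization (moment_matrix W) S1 S2 h) :
  let P1 := monic_seq S1 in
  let P2 := monic_seq S2 in
  [/\ forall r k : nat, sobolev W (P1 r) (P2 k) = h r * (r == k)%:R,
      forall l r : nat, (r <= l)%N ->
        sobolev W (P1 l) 'X^r = (l == r)%:R * h r /\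
        sobolev W 'X^r (P2 l) = h r * (r == l)%:R &
      forall l r : nat, (r <= l)%N ->
        \sum_(k < l.+1) \sum_(j < r.+1)
          mm_int W k j (fun x : R => (P1 l)^`(k).[x] * ('X^r)^`(j).[x])
          = (if (r < l)%N then 0 else h l) /\
        \sum_(k < l.+1) \sum_(j < r.+1)
          mm_int W j k (fun x : R => ('X^r)^`(j).[x] * (P2 l)^`(k).[x])
          = (if (r < l)%N then 0 else h l)].
Proof.
case: WS => S1u S2u [T1 [T2 [S1T1 S2T2 WG]]] P1 P2.
have [S1t _] := S1u; have [S2t _] := S2u.
have [T1t S1T1id _] := S1T1; have [T2t S2T2id _] := S2T2.
have P1X (l p : nat) : sobolev W (P1 l) 'X^p = h l * T2 p l.
  by rewrite sobolev_monic_seql// -(LU_mul_left h T1t T2t l p S1t S1T1id) -WG.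
have XP2 (p l : nat) : sobolev W 'X^p (P2 l) = T1 p l * h l.
  by rewrite sobolev_monic_seqr// -(LU_mul_right h T1t T2t p l S2t S2T2id) -WG.
have P1Xle (l r : nat) : (r <= l)%N -> sobolev W (P1 l) 'X^r = (l == r)%:R * h l.
  by move=> rl; rewrite P1X (simx_inverse_entry S2u S2T2 rl) mulrC eq_sym.
have XP2le (l r : nat) : (r <= l)%N -> sobolev W 'X^r (P2 l) = h l * (r == l)%:R.
  by move=> rl; rewrite XP2 (simx_inverse_entry S1u S1T1 rl) mulrC.
split.
- (* (P1_r, P2_k) = sum_j S2_kj h_r T2_jr is h_r times an entry of S2 T2. *)
  move=> r k; rewrite sobolev_monic_seqr//.
  under eq_bigr do rewrite P1X mulrCA.
  rewrite -big_distrr /= -(lower_triangular_mulE _ _ S2t (ltnSn k)) S2T2id.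
  by rewrite /simx_id /simx_diag mul1r eq_sym.
- move=> l r rl; rewrite P1Xle// XP2le//.
  by case: eqVneq => [->|]; rewrite ?eqxx// !(mul0r, mulr0).
- move=> l r rl.
  rewrite -(sobolev_size W (size_monic_seq S1 l)) ?size_polyXn//.
  have e : h l * (r == l)%:R = if (r < l)%N then 0 else h l.
    by rewrite ltn_neqAle rl andbT; case: eqP; rewrite (mulr1, mulr0).
  split; first by rewrite P1Xle// mulrC eq_sym.
  (* The sum lists the orders of P2 first, the form those of x^r. *)
  rewrite exchange_big /= -(@sobolev_size _ _ W 'X^r (P2 l) r.+1 l.+1).
  - by rewrite XP2le.
  - by rewrite size_polyXn.
  - exact: size_monic_seq.
Qed.
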